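(* Let $\Gamma_1=(V_1,E_1)$ and $\Gamma_2=(V_2,E_2)$ be loopless graphs with $V_1\cap V_2=\emptyset$ and $V_1\neq\emptyset\neq V_2$, let $\Gamma=\Gamma_1\vee\Gamma_2$ with vertex set $V=V_1\sqcup V_2$, and let $u\in V$. Let $\alpha\in\mathrm{Nil}_k(\Gamma)$. Then there exists $\beta\in\mathrm{Nil}_k(\Gamma)$ such that $\beta$ is $u$-centred and $\mathrm{mon}(\beta)\preccurlyeq_u\mathrm{mon}(\alpha)$.
   Context: The join $\Gamma_1\vee\Gamma_2$ is the disjoint union plus an edge between each vertex of $V_1$ and each vertex of $V_2$. Write $n_i=|V_i|$. An animation of a graph $\Gamma=(V,E)$ is a partial function $\alpha:V\dashrightarrow V$ with $v^\alpha\sim v$ for all $v\in\mathrm{Dom}(\alpha)$; it is nilpotent if some iterate $\alpha^m$ ($m\ge1$) is nowhere defined; $\mathrm{Nil}_k(\Gamma)$ denotes nilpotent animations with $|\mathrm{Dom}(\alpha)|=k$; $\mathrm{mon}(\alpha)=\prod_{v\in\mathrm{Dom}(\alpha)}X_{v^\alpha}$. For $u\in V_i$ and $\{i,j\}=\{1,2\}$, $\alpha\in\mathrm{Nil}_k(\Gamma)$ is $u$-centred if $|V_j\cap\mathrm{Dom}(\alpha)|=\min(k,n_j)$ and $v^\alpha=u$ for all $v\in V_j\cap\mathrm{Dom}(\alpha)$. Let $\mathscr C_uV=\{x\in\mathbf R_{\ge0}V: x_u\le x_v\text{ for all }v\in V\}$; for $a,b\in\mathbf ZV$, $a\preccurlyeq_u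 b$ iff $(b-a)\cdot x\ge0$ for all $x\in\mathscr C_uV$ (standard inner product); for Laurent monomials, $X_V^a\preccurlyeq_u X_V^b$ iff $a\preccurlyeq_u b$. *)

(* Defs.v *)
From mathcomp Require Import all_boot all_order all_algebra.
From mathcomp Require Import all_classical all_reals.

Set Implicit Arguments.
Unset Strict Implicit.
Unset Printing Implicit Defensive.

Import Order.TTheory GRing.Theory Num.Theory.

(* Finite undirected graphs without parallel edges; loops are allowed unless
   [loopless] is assumed. *)
Record graph := Graph {
  vertex :> finType;
  adj : rel vertex;
  adj_sym : symmetric adj }.

Definition loopless (G : graph) : Prop := irreflexive (@adj G).

Section Join.
Variables G1 G2 : graph.

(* The sum type makes the two vertex sets disjoint. *)
Definition join_adj : rel (G1 + G2)%type := fun x y =>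
  match x, y with
  | inl v, inl w => adj v w
  | inr v, inr w => adj v w
  | _, _ => true
  end.

Lemma join_adj_sym : symmetric join_adj.
Proof. by move=> [v|v] [w|w] //=; apply: adj_sym. Qed.

Definition join : graph := Graph join_adj_sym.

(* The set V_j, where u belongs to V_i and {i, j} = {1, 2}. *)
Definition opposite (u : join) : {set join} :=
  match u with
  | inl _ => [set (inr w : join) | w in [set: G2]]
  | inr _ => [set (inl w : join) | w in [set: G1]]
  end.

End Join.

Section Animations.
Variable G : graph.

Definition pfun := {ffun G -> option G}.

Definition dom (a : pfun) : {set G} := [set v | a v != None].

Definition animation (a : pfun) : Prop :=
  forall v w : G, a v = Some w -> adj w v.

Definition nilpotent (a : pfun) : Prop :=
  exists2 m : nat, 0 < m & forall v : G, iter m (obind a) (Some v) = None.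

Definition Nilk (k : nat) (a : pfun) : Prop :=
  [/\ animation a, nilpotent a & #|dom a| = k].

End Animations.

Definition centred (G1 G2 : graph) (k : nat) (u : join G1 G2)
    (a : pfun (join G1 G2)) : Prop :=
  #|opposite u :&: dom a| = minn k #|opposite u| /\
  forall v, v \in opposite u :&: dom a -> a v = Some u.

Local Open Scope ring_scope.

Section LaurentMonomials.
Variable V : finType.

(* [LMonom e] is the Laurent monomial with exponent vector [e] in Z^V. *)
Record lmonom := LMonom { lexp : {ffun V -> int} }.

Definition lone : lmonom := LMonom 0.
Definition lmul (p q : lmonom) : lmonom := LMonom (lexp p + lexp q).
Definition lvar (v : V) : lmonom := LMonom [ffun w => (w == v)%:Z].

End LaurentMonomials.

(* The default value [v] of [odflt] is never used, since [v] is in [dom a]. *)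
Definition mon (G : graph) (a : pfun G) : lmonom G :=
  \big[@lmul G/lone G]_(v in dom a) lvar (odflt v (a v)).

Section Preorder.
Variables (R : realType) (V : finType).

Definition dotp (x y : {ffun V -> R}) : R := \sum_v x v * y v.

Definition cone (u : V) : set {ffun V -> R} :=
  [set x | (forall v, 0 <= x v) /\ (forall v, x u <= x v)]%classic.

Definition intvec (c : {ffun V -> int}) : {ffun V -> R} :=
  [ffun v => (c v)%:~R].

Definition vle (u : V) (a b : {ffun V -> int}) : Prop :=
  forall x, cone u x -> 0 <= dotp (intvec (b - a)) x.

Definition lmonom_le (u : V) (p q : lmonom V) : Prop :=
  vle u (lexp p) (lexp q).

End Preorder.

(* Main.v *)
Require Import Defs.
From mathcomp Require Import all_boot all_order all_algebra.
From mathcomp Require Import all_classical all_reals.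
From mathcomp Require Import fintype finset fingroup perm zify.

(** Nilpotent animations are those admitting a rank that strictly decreases along
    arrows.  Redirect vertices of [V_j] to [u] and keep [alpha] on a suitable set
    [D] of [k - n_j] vertices of [V_i], where [alpha] is already defined.  A cycle
    can only arise if the [alpha]-path of [u] inside [V_i] leaves [V_i] at some
    vertex [t], say with [t^alpha = w] in [V_j]; so [t] must be kept out of [D].
    If there are too few vertices for this, then [alpha] is defined on all of
    [V_j], so some [r] in [V_i] is outside the domain, and [r -> w] can replace
    [t -> w] without changing the monomial. *)

Set Implicit Arguments.
Unset Strict Implicit.
Unset Printing Implicit Defensive.

Import Order.TTheory GRing.Theory Num.Theory.

(** From left to right, the rank of [v] is the number of iterations after which the orbit of [v]
    dies; from right to left, a bound on the ranks bounds that number. *)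
Lemma nilpotentP (G : graph) (a : pfun G) :
  nilpotent a <-> exists h : G -> nat, forall v w, a v = Some w -> h w < h v.
Proof.
split=> [[m _ am]|[h hP]].
  have ex v : exists i, iter i (obind a) (Some v) == None by exists m; apply/eqP.
  exists (fun v => ex_minn (ex v)) => v w avw.
  case: (ex_minnP (ex v)) => -[|j] // + _; rewrite iterSr /= avw => jw.
  by case: ex_minnP => i _ /(_ _ jw).
have iterN n : iter n (obind a) None = None by elim: n => //= n ->.
have it n : forall v, h v < n -> iter n (obind a) (Some v) = None.
  elim: n => // n IHn v hv; rewrite iterSr /=.
  case av: (a v) => [w|]; last exact: iterN.
  by apply: IHn; apply: leq_trans (hP _ _ av) _; rewrite -ltnS.
exists (\max_v h v).+1 => // v; apply: it.
by rewrite ltnS leq_bigmax.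
Qed.

(** [S] is the vertex set of the [a]-path from [u] as long as it avoids [A], and [t] is its last
    vertex: there the path either stops or enters [A]. The path is finite because [h] decreases
    along it. *)
Lemma path_exit (G : graph) (a : pfun G) (h : G -> nat) (A : {set G}) (u : G) :
  (forall v w, a v = Some w -> h w < h v) -> u \notin A ->
  exists (S : {set G}) (t : G),
    [/\ u \in S, t \in S, forall v, v \in S -> v \notin A,
        forall v, v \in S -> v != t -> exists2 w, w \in S & a v = Some w
      & forall w, a t = Some w -> w \in A].
Proof.
move=> hP; have [n] := ubnP (h u); elim: n u => // n IHn u hu uA.
have [auA|[w au wA]] : (forall w, a u = Some w -> w \in A) \/
    (exists2 w, a u = Some w & w \notin A).
  case au: (a u) => [w|]; last by left.
  have [wA|wA] := boolP (w \in A); last by right; exists w.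
  by left=> w' [<-].
  exists [set u], u; split; rewrite ?set11 // => v /set1P-> //.
  by rewrite eqxx.
have [|S [t [wS tS SA St tA]]] := IHn w _ wA.
  by apply: leq_trans (hP _ _ au) _; rewrite -ltnS.
exists (u |: S), t; split=> //; rewrite ?setU11 ?in_setU1 ?tS ?orbT // => v.
  by move=> /setU1P[->|/SA].
move=> /setU1P[-> _|vS vt]; first by exists w; rewrite // in_setU1 wS orbT.
by have [w' w'S avw'] := St v vS vt; exists w'; rewrite // in_setU1 w'S orbT.
Qed.

Local Open Scope ring_scope.

Section Weight.
Variables (R : realType) (G : graph).
Implicit Types (a b : pfun G) (x : {ffun G -> R}).

(** The pairing of [x] with the exponent vector of [mon a], as a sum over sources of arrows;
    undefined vertices contribute 0. *)
Definition weight a x : R := \sum_v oapp x 0 (a v).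

Lemma dotp_mon a x : dotp (intvec R (lexp (mon a))) x = weight a x.
Proof.
rewrite /weight /mon (big_morph (@lexp G) (id1 := 0) (op1 := +%R)) //.
have -> : dotp (intvec R (\sum_(v in dom a) lexp (lvar (odflt v (a v))))) x =
    \sum_(v in dom a) dotp (intvec R (lexp (lvar (odflt v (a v))))) x.
  rewrite /dotp exchange_big /=; apply: eq_bigr => w _.
  rewrite -mulr_suml ffunE sum_ffunE raddf_sum /=; congr (_ * _).
  by apply: eq_bigr => v _; rewrite [RHS]ffunE.
rewrite big_mkcond /=; apply: eq_bigr => v _; rewrite inE.
case: (a v) => [w|] //=.
rewrite /dotp (bigD1 w) //= big1 ?addr0.
  by rewrite !ffunE eqxx mul1r.
by move=> w' /negbTE w'w; rewrite !ffunE w'w mul0r.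
Qed.

Lemma lmonom_leP u a b :
  (forall x, cone u x -> weight a x <= weight b x) ->
  lmonom_le R u (mon a) (mon b).
Proof.
move=> ab x ux.
suff -> : dotp (intvec R (lexp (mon b) - lexp (mon a))) x =
    dotp (intvec R (lexp (mon b))) x - dotp (intvec R (lexp (mon a))) x.
  by rewrite !dotp_mon subr_ge0 ab.
rewrite /dotp -sumrB; apply: eq_bigr => v _.
by rewrite !ffunE rmorphB mulrBl.
Qed.

End Weight.

Lemma subset_of_card (T : finType) (B : {set T}) n :
  (n <= #|B|)%N -> exists2 D : {set T}, D \subset B & #|D| = n.
Proof.
move=> nB; have : (0 < #|[set D : {set T} | D \subset B & #|D| == n]|)%N.
  by rewrite cards_draws bin_gt0.
by case/card_gt0P => D; rewrite inE => /andP[DB /eqP]; exists D.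
Qed.

Section Centring.
Variables (R : realType) (G : graph) (A : {set G}) (u : G).
Hypothesis uA : u \notin A.
Hypothesis adjA : forall v w, v \in A -> w \notin A -> adj v w.

(* The rank of [a] only has to decrease along arrows between vertices outside
   [A]: the other arrows are harmless once [A'] is redirected to [u]. *)
Lemma recentre (a : pfun G) (h : G -> nat) (S A' D : {set G}) :
  animation a ->
  (forall v w, v \in D -> a v = Some w -> w \notin A -> (h w < h v)%N) ->
  A' \subset A -> D \subset dom a :\: A ->
  u \in S -> (forall v, v \in S -> v \notin A) ->
  (forall v w, v \in S -> v \in D -> a v = Some w -> w \in S) ->
  (#|A'| + #|D| = #|dom a|)%N ->
  exists b : pfun G,
    [/\ Nilk #|dom a| b, A :&: dom b = A', forall v, v \in A' -> b v = Some u
      & forall x : {ffun G -> R}, cone u x -> weight b x <= weight a x].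
Proof.
move=> aP hP A'A DA uS SA Sa cardD.
have DP v : v \in D -> v \notin A /\ a v != None.
  by move=> /(subsetP DA); rewrite !inE => /andP[].
have A'P v : v \in A' -> v \in A by apply: (subsetP A'A).
have A'D v : v \in D -> v \notin A'.
  by move=> /DP[vA _]; apply: contra vA; apply: A'P.
pose b : pfun G :=
  [ffun v => if v \in A' then Some u else if v \in D then a v else None].
have domb : dom b = A' :|: D.
  apply/setP => v; rewrite !inE ffunE; case: ifP => // _.
  by case: ifP => // /DP[].
exists b; split.
- split.
  + move=> v w; rewrite ffunE; case: ifP => [/A'P vA [<-]|_].
      by rewrite adj_sym adjA.
    by case: ifP => // _; apply: aP.
  + apply/nilpotentP; pose N := (\max_v h v).+1.
    have hN v : (h v < N)%N by rewrite ltnS leq_bigmax.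
    (* Three layers: [S] at the bottom, which [b] does not leave from within [S]; then [A], whose
       arrows now drop to [u] in [S]; on top the other vertices, where [h] still decreases. *)
    exists (fun v => if v \in S then h v else if v \in A then N
                     else (N.+1 + h v)%N) => v w.
    rewrite ffunE; case: ifP => [/A'P vA [<-]|_].
      by rewrite uS vA; case: ifP => // /SA; rewrite vA.
    case: ifP => // vD avw; have [/negbTE vA _] := DP v vD.
    rewrite vA; have := hN w; have := hN v.
    have := hP v w vD avw; have := Sa v w.
    case: (boolP (v \in S)) => vS.
      move=> /(_ isT vD avw) wS; rewrite wS => /(_ (SA _ wS)) //.
    move=> _; case: (w \in S); case: (w \in A); lia.
  + rewrite domb cardsU -cardD (_ : A' :&: D = set0) ?cards0 ?subn0 //.
    apply/setP => v; rewrite !inE; apply/negbTE/negP => /andP[vA' /A'D].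
    by rewrite vA'.
- apply/setP => v; rewrite domb !inE.
  have [/A'P->|] //= := boolP (v \in A').
  by have [/DP[/negbTE->]|_] := boolP (v \in D); rewrite ?andbF.
- by move=> v vA'; rewrite ffunE vA'.
move=> x [x0 xu].
have wb : weight b x = x u *+ #|A'| + \sum_(v in D) oapp x 0 (a v).
  rewrite -sumr_const [in RHS]big_mkcond [X in _ + X]big_mkcond -big_split /=.
  apply: eq_bigr => v _; rewrite ffunE.
  have [vA'|vA'] := boolP (v \in A').
    by rewrite ifN ?addr0 //; apply: contraL vA'; apply: A'D.
  by rewrite add0r; case: ifP.
have DS : D \subset dom a by apply: subset_trans DA (subsetDl _ _).
have wa : weight a x = \sum_(v in dom a) oapp x 0 (a v).
  rewrite [RHS]big_mkcond; apply: eq_bigr => v _; rewrite inE.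
  by case: (a v).
(* The arrows from [D] cancel. The remaining arrows of [a] and [b] are equal in number, and those of
   [b] all end at [u], where [x] is smallest. *)
rewrite wa wb [leRHS](big_setID D) /= (setIidPr DS) [leLHS]addrC lerD2l.
have -> : #|A'| = #|dom a :\: D| by rewrite cardsDS // -cardD addnK.
rewrite -sumr_const; apply: ler_sum => v; rewrite !inE => /andP[_].
by case: (a v) => [w|] //= _.
Qed.

Lemma exists_centred (a : pfun G) (k : nat) : Nilk k a ->
  exists b : pfun G,
    [/\ Nilk k b, #|A :&: dom b| = minn k #|A|,
        forall v, v \in A :&: dom b -> b v = Some u
      & forall x : {ffun G -> R}, cone u x -> weight b x <= weight a x].
Proof.
move=> [aP /nilpotentP[h hP] <-].
have [A' A'A cardA'] := subset_of_card (geq_minr #|dom a| #|A|).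
have [S [t [uS tS SA St tA]]] := path_exit hP uA.
have cardID := cardsID A (dom a).
have leA : (#|dom a :&: A| <= #|A|)%N by rewrite subset_leq_card ?subsetIr.
(* Truncated subtraction makes [D] empty when the domain is no larger than [A], so the sizes of [A']
   and [D] always add up to that of the domain. *)
suff [a' [D [[a'P wa' DA] [cardD carda' hP' Sa']]]] :
    exists (a' : pfun G) (D : {set G}),
    [/\ animation a', forall x : {ffun G -> R}, weight a' x = weight a x
      & D \subset dom a' :\: A] /\
    [/\ #|D| = (#|dom a| - #|A|)%N, #|dom a'| = #|dom a|,
        forall v w, v \in D -> a' v = Some w -> w \notin A -> (h w < h v)%N
      & forall v w, v \in S -> v \in D -> a' v = Some w -> w \in S].
  have [|b [bN bA bu bw]] := recentre a'P hP' A'A DA uS SA Sa'.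
    by rewrite carda' cardD cardA'; lia.
  exists b; split; rewrite ?bA //; first by rewrite -carda'.
  by move=> x ux; rewrite -wa' bw.
(* Only the arrow of [t] can leave [S]. *)
have keep (D : {set G}) : D \subset (dom a :\: A) :\ t -> forall v w,
    v \in S -> v \in D -> a v = Some w -> w \in S.
  move=> Dt v w vS /(subsetP Dt); rewrite !inE => /andP[vt _].
  by have [w' w'S ->] := St v vS vt; case=> <-.
have [le|gt] := leqP (#|dom a| - #|A|)%N #|(dom a :\: A) :\ t|.
  have [D DA cardD] := subset_of_card le.
  exists a, D; split; split=> //.
  - exact: subset_trans DA (subsetDl _ _).
  - by move=> v w _ /hP.
  - exact: keep DA.
(* Too few vertices remain without [t]. Counting then forces [t] into the domain and [A] to lie
   inside it. *)
have := cardsD1 t (dom a :\: A); case: (boolP (t \in _)) => [tD|_]; last first.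
  by move: gt cardID leA; lia.
move=> cardt.
have AD : A \subset dom a.
  apply/setIidPr/eqP; rewrite eqEcard subsetIr /=; lia.
(* An arrow from a vertex of least rank would have to decrease the rank, so [r] has none. *)
have [r _ /(_ _ isT) rmin] := arg_minnP (P := predT) h (isT : predT u).
have ar : a r = None.
  by case ar: (a r) => [w|] //; have := rmin w; rewrite leqNgt (hP _ _ ar).
have rA : r \notin A.
  by apply/negP => /(subsetP AD); rewrite inE ar.
have tnA : t \notin A by apply: SA.
have [w atw] : exists w, a t = Some w.
  by move: tD; rewrite !inE => /andP[_]; case: (a t) => // w _; exists w.
have wA : w \in A by apply: tA.
have rt : r != t by apply/eqP => rt; rewrite -rt ar in atw.
have rS : r \notin S.
  by apply/negP => rS; have [w' _] := St r rS rt; rewrite ar.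
(* The transposition hands the arrow of [t] to [r]. This may create a cycle, but one through [w] in
   [A], where no rank condition is imposed. *)
pose a' : pfun G := [ffun v => a (tperm t r v)].
have a'E v : v != t -> v != r -> a' v = a v.
  by move=> vt vr; rewrite ffunE tpermD // eq_sym.
have a't : a' t = None by rewrite ffunE tpermL.
have a'r : a' r = Some w by rewrite ffunE tpermR.
have doma' : dom a' = tperm t r @^-1: dom a.
  by apply/setP => v; rewrite !inE ffunE.
have carda' : #|dom a'| = #|dom a|.
  by rewrite doma' card_preimset //; apply: perm_inj.
have cardDa' : #|dom a' :\: A| = #|dom a :\: A|.
  have -> : dom a' :\: A = tperm t r @^-1: (dom a :\: A).
    apply/setP => v; rewrite doma' !inE.
    by case: tpermP => [->|->|//]; rewrite ?(negbTE rA) ?(negbTE tnA).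
  by rewrite card_preimset //; apply: perm_inj.
exists a', (dom a' :\: A); split; split=> //.
- move=> v w'; have [->|vt] := eqVneq v t; first by rewrite a't.
  have [->|vr] := eqVneq v r; last by rewrite a'E //; apply: aP.
  by rewrite a'r => -[<-]; apply: adjA.
- move=> x; rewrite /weight [RHS](reindex_perm (tperm t r)) /=.
  by apply: eq_bigr => v _; rewrite ffunE.
- by rewrite cardDa'; lia.
- move=> v w' _; have [->|vt] := eqVneq v t; first by rewrite a't.
  have [->|vr] := eqVneq v r; last by rewrite a'E // => /hP.
  by rewrite a'r => -[<-]; rewrite wA.
- move=> v w' vS _; have [->|vt] := eqVneq v t; first by rewrite a't.
  have vr : v != r by apply: contraNneq rS => <-.
  by rewrite a'E //; have [w'' w''S ->] := St v vS vt; case=> <-.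
Qed.

End Centring.

Theorem theorem9p3 (R : realType) (G1 G2 : graph)
    (loopless1 : loopless G1) (loopless2 : loopless G2)
    (nonempty1 : (0 < #|G1|)%N) (nonempty2 : (0 < #|G2|)%N)
    (u : join G1 G2) (k : nat)
    (alpha : pfun (join G1 G2)) (alphaP : Nilk k alpha) :
  exists beta : pfun (join G1 G2),
    [/\ Nilk k beta, centred k u beta & lmonom_le R u (mon beta) (mon alpha)].
Proof.
(* Membership in [opposite u] depends only on the summand, which reduces both conditions on [A] to a
   case analysis. *)
have inl_opp (v : G1) : ((inl v : join G1 G2) \in opposite u) = ~~ is_inl u.
  case: (u) => u' /=; last by apply: imset_f.
  by apply/negbTE/imsetP => -[].
have inr_opp (v : G2) : ((inr v : join G1 G2) \in opposite u) = is_inl u.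
  case: (u) => u' /=; first by apply: imset_f.
  by apply/negbTE/imsetP => -[].
have uA : u \notin opposite u.
  by case: (u) inl_opp inr_opp => v inl_opp inr_opp; rewrite ?inl_opp ?inr_opp.
have adjA v w : v \in opposite u -> w \notin opposite u -> adj v w.
  by case: v w => v [] w; rewrite ?inl_opp ?inr_opp //; case: is_inl.
have [b [bN cardb bu bw]] := exists_centred R uA adjA alphaP.
by exists b; split=> //; apply: lmonom_leP.
Qed.
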